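(* Suppose that for every positive integer $n$ there exists $k\in\mathbb{N}$ such that $\mathfrak{R}^k(n)=1$. Then there is no odd $2^k$-perfect number for any integer $k\ge 1$; in particular, there is no odd perfect number.
   Context: $\sigma(n)=\sum_{d\mid n} d$ is the sum-of-divisors function. The map $\mathfrak{R}$ on positive integers is defined by $\mathfrak{R}(n)=\sigma(n)$ if $n$ is odd and $\mathfrak{R}(n)=n/2$ if $n$ is even. Its iterates are $\mathfrak{R}^0(n)=n$ and $\mathfrak{R}^{k+1}(n)=\mathfrak{R}(\mathfrak{R}^k(n))$ for $k\ge 0$. A positive integer $N$ is an odd $2^k$-perfect number ($k\ge 1$) if $N$ is odd and $\sigma(N)=2^kN$; it is an odd perfect number if $N$ is odd and $\sigma(N)=2N$. *)

(* Defs.v *)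
From mathcomp Require Import all_boot.

Set Implicit Arguments.
Unset Strict Implicit.
Unset Printing Implicit Defensive.

Definition sigma (n : nat) : nat := \sum_(d <- divisors n) d.

(* A map on positive integers; its value at 0 is a junk value. *)
Definition frakR (n : nat) : nat := if odd n then sigma n else n %/ 2.

Definition odd_pow2_perfect (k N : nat) : Prop :=
  [/\ 0 < N, odd N & sigma N = 2 ^ k * N].

Definition odd_perfect (N : nat) : Prop :=
  [/\ 0 < N, odd N & sigma N = 2 * N].

(* Main.v *)
Require Import Defs.
From mathcomp Require Import all_boot.

(** If [sigma N = 2 ^ k * N] with [N] odd, then one step multiplies [N] by
    [2 ^ k] and [k] halvings bring it back, so [N] is periodic. A periodic point
    whose orbit reaches the fixed point [1] is [1] itself, but [sigma 1 = 1]. *)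

(** After [j * p.+1] steps, [j] full periods, the orbit is back at [x]; but that is at least [j]
    steps, so it already sits at [a]. *)
Lemma periodic_reaching_fixpoint (T : Type) (f : T -> T) (a x : T) (p j : nat) :
  f a = a -> iter p.+1 f x = x -> iter j f x = a -> x = a.
Proof.
move=> fa fx xa.
have <- : iter (j * p.+1) f x = x by rewrite iterM iter_fix.
by rewrite mulnS addnC iterD xa iter_fix.
Qed.

Lemma sigma1 : sigma 1 = 1.
Proof. by rewrite /sigma big_seq1. Qed.

Lemma iter_frakR_pow2 (k n : nat) : iter k frakR (2 ^ k * n) = n.
Proof.
elim: k => [|k IHk]; first by rewrite mul1n.
by rewrite iterSr /frakR expnS -mulnA oddM /= mulKn.
Qed.

Lemma odd_pow2_perfect_periodic (k N : nat) :
  odd_pow2_perfect k N -> iter k.+1 frakR N = N.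
Proof. by case=> _ oddN sN; rewrite iterSr {2}/frakR oddN sN iter_frakR_pow2. Qed.

Theorem mainTheorem6 :
  (forall n : nat, 0 < n -> exists k : nat, iter k frakR n = 1) ->
  (forall k : nat, 1 <= k -> ~ exists N : nat, odd_pow2_perfect k N) /\
  ~ exists N : nat, odd_perfect N.
Proof.
move=> reach1.
have no_pow2 k : 1 <= k -> ~ exists N, odd_pow2_perfect k N.
  move=> k_gt0 [N perfN]; have [N_gt0 _ sN] := perfN.
  have [j jN] := reach1 N N_gt0.
  have N1 : N = 1.
    have periodN := odd_pow2_perfect_periodic _ _ perfN.
    (* [sigma1] proves [frakR 1 = 1]: as [1] is odd, [frakR 1] reduces to [sigma 1]. *)
    exact: (periodic_reaching_fixpoint _ frakR 1 N k j sigma1 periodN jN).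
  move: sN; rewrite N1 sigma1 muln1 => pow1.
  (* The bound [k < 2 ^ k] becomes [k < 1]. *)
  by have := ltn_expl k (ltnSn 1); rewrite -pow1 ltnNge k_gt0.
(* [2 ^ 1] computes to [2], so [perfN] is the case [k = 1] by conversion. *)
by split=> // -[N perfN]; apply: (no_pow2 1) => //; exists N.
Qed.
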